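(* For every convex polygon $Q$ with no two adjacent edges collinear, and every pyramid $\operatorname{Pyr}(Q)\subset\mathbb R^3$ over $Q$ (the convex hull of $Q$, placed in an affine plane, and an apex outside that plane), \[ \operatorname{Belt}_{\mathbb Q}(\operatorname{Pyr}(Q))\cong\bigoplus_{\{e,f\}\parallel}\mathbb Q^2, \] where the direct sum is over unordered pairs $\{e,f\}$ of (distinct) parallel edges of $Q$.
   Context: A convex polyhedron $P\subset\mathbb R^3$ means a compact full-dimensional convex polytope. Two points of $P$ are antipodal if there are two parallel supporting planes of $P$, one through each point, that contain $P$ between them. The antipodal graph $G_A(P)$ has as vertices the vertices of $P$, with an edge $vw$ whenever $v,w$ are distinct antipodal vertices. The antipodal square complex $X(P)$ is the two-dimensional finite CW complex obtained from $G_A(P)$ by attaching one square 2-cell for every unordered pair $\{e,f\}$ of distinct edges of $P$ whose midpoints are antipodal: if $e=vv'$ and $f=ww'$, the square is attached along the four-cycle $v-w-v'-w'-v$ (such $e,f$ are disjoint, so the four vertices are distinct, and the four vertex pairs used are antipodal). A rational antipodal belt is an element $Z\in C_2(X(P);\mathbb Q)$ (a rational combination of oriented square cells) with cellular boundary $\partial Z=0$; $\operatorname{Belt}_{\mathbb Q}(P)$ is the $\mathbb Q$-vector space of rational antipodal belts. *)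

(* Defs.v *)
From HB Require Import structures.
From mathcomp Require Import all_boot all_order all_algebra finmap.
From mathcomp Require Import all_classical all_reals convex.
From mathcomp Require Import ring lra.

Set Implicit Arguments.
Unset Strict Implicit.
Unset Printing Implicit Defensive.

Import Order.TTheory GRing.Theory Num.Theory.
Local Open Scope classical_set_scope.
Local Open Scope ring_scope.

Section Polytope.
Variable R : realType.

Definition hull d (S : set 'rV[R]_d) : set 'rV[R]_d :=
  smallest (@convex_set R 'rV[R]_d) S.

Definition dot d (u v : 'rV[R]_d) : R := \sum_i u 0 i * v 0 i.

Definition midpoint d (u v : 'rV[R]_d) : 'rV[R]_d := 2^-1 *: (u + v).

Implicit Types (P : set 'rV[R]_3) (v w x y n : 'rV[R]_3).

(* The plane [dot n x = c] supports P, with n as outward normal. *)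
Definition supporting_plane P n (c : R) : Prop :=
  [/\ n != 0, forall x, P x -> dot n x <= c & exists2 x, P x & dot n x = c].

Definition face P (F : set 'rV[R]_3) : Prop :=
  exists n c, supporting_plane P n c /\ F = [set x | P x /\ dot n x = c].

Definition vertices P : set 'rV[R]_3 := [set v | face P [set v]].

(* vw is an edge: the segment from v to w is a one-dimensional face. *)
Definition edge P v w : Prop := v <> w /\ face P (hull [set v; w]).

(* The opposite outward normals put P between the two parallel planes. *)
Definition antipodal P x y : Prop :=
  [/\ P x, P y & exists n, supporting_plane P n (dot n x)
                        /\ supporting_plane P (- n) (dot (- n) y)].

Definition antipodal_graph P v w : Prop :=
  [/\ vertices P v, vertices P w, v <> w & antipodal P v w].

(* The four-cycle v - w - v' - w' - v along which the square of the pair of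
   edges e = vv' and f = ww' is attached. *)
Definition antipodal_square P v w v' w' : Prop :=
  [/\ edge P v v', edge P w w', [set v; v'] <> [set w; w']
    & antipodal P (midpoint v v') (midpoint w w')].

(* [fset_set] sends an infinite set to the empty one; a polytope has finitely
   many vertices. *)
Definition vert P : {fset 'rV[R]_3} := fset_set (vertices P).

End Polytope.

(* Oriented cellular chains: a 1-chain is a function on oriented edges that
   changes sign when the edge is reversed, and a 2-chain is a function on
   oriented squares (a square with a choice of starting corner and direction of
   its attaching four-cycle) that is unchanged by a rotation of the cycle and
   changes sign when the cycle is reversed. Each cell thus contributes one copy
   of rat. *)
Section Chains.
Variables (R : realType) (P : set 'rV[R]_3).
Let V : finType := vert P.

Definition chain1_pred : {pred {ffun V * V -> rat^o}} :=
  [pred z : {ffun V * V -> rat^o} | `[< (forall a b, z (a, b) != 0 ->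
                   antipodal_graph P (val a) (val b))
              /\ (forall a b, z (b, a) = - z (a, b)) >]].

Definition chain2_pred : {pred {ffun V * V * V * V -> rat^o}} :=
  [pred z : {ffun V * V * V * V -> rat^o} | `[< [/\ forall a b c d, z (a, b, c, d) != 0 ->
                     antipodal_square P (val a) (val b) (val c) (val d),
                   forall a b c d, z (b, c, d, a) = z (a, b, c, d)
                 & forall a b c d, z (a, d, c, b) = - z (a, b, c, d)] >]].

Lemma chain1_closed : submod_closed chain1_pred.
Proof.
split=> [|k x y /asboolP[x1 x2] /asboolP[y1 y2]]; apply/asboolP.
  by split=> a b; rewrite !ffunE ?eqxx // oppr0.
split=> a b; rewrite !ffunE.
  have [->|/x1//] := eqVneq (x (a, b)) 0; rewrite scaler0 add0r; exact: y1.
by rewrite x2 y2 scalerN opprD.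
Qed.

Lemma chain2_closed : submod_closed chain2_pred.
Proof.
split=> [|k x y /asboolP[x1 x2 x3] /asboolP[y1 y2 y3]]; apply/asboolP.
  by split=> a b c d; rewrite !ffunE ?eqxx // oppr0.
split=> a b c d; rewrite !ffunE.
- have [->|/x1//] := eqVneq (x (a, b, c, d)) 0; rewrite scaler0 add0r.
  exact: y1.
- by rewrite x2 y2.
- by rewrite x3 y3 scalerN opprD.
Qed.

HB.instance Definition _ :=
  GRing.isSubmodClosed.Build rat {ffun V * V -> rat^o} chain1_pred
    chain1_closed.
HB.instance Definition _ :=
  GRing.isSubmodClosed.Build rat {ffun V * V * V * V -> rat^o} chain2_pred
    chain2_closed.

Record chain1 := Chain1 {
  chain1_val :> {ffun V * V -> rat^o}; _ : chain1_val \in chain1_pred }.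
HB.instance Definition _ := [isSub for chain1_val].
HB.instance Definition _ := [Choice of chain1 by <:].
HB.instance Definition _ := [SubChoice_isSubLmodule of chain1 by <:].

Record chain2 := Chain2 {
  chain2_val :> {ffun V * V * V * V -> rat^o};
  _ : chain2_val \in chain2_pred }.
HB.instance Definition _ := [isSub for chain2_val].
HB.instance Definition _ := [Choice of chain2 by <:].
HB.instance Definition _ := [SubChoice_isSubLmodule of chain2 by <:].

(* A square whose boundary runs through the oriented edge (a, b) has exactly
   one reading (a, b, c, d) of its four-cycle starting with that edge. *)
Definition boundary_fun (z : chain2) : {ffun V * V -> rat^o} :=
  [ffun e => \sum_(f : V * V) z (e.1, e.2, f.1, f.2)].

Lemma face_midpoint (n v w : 'rV[R]_3) (c : R) :
  dot n v <= c -> dot n w <= c -> dot n (midpoint v w) = c ->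
  dot n v = c /\ dot n w = c.
Proof.
have -> : dot n (midpoint v w) = 2^-1 * (dot n v + dot n w).
  rewrite /dot -big_split /= mulr_sumr; apply: eq_bigr => i _.
  by rewrite !mxE; lra.
lra.
Qed.

Lemma antipodal_corners (v v' w w' : 'rV[R]_3) :
  P v -> P v' -> P w -> P w' ->
  antipodal P (midpoint v v') (midpoint w w') -> antipodal P v w.
Proof.
move=> Pv Pv' Pw Pw' [_ _ [n [[n0 len _] [n0' len' _]]]]; split=> //.
have [nv _] := face_midpoint (len _ Pv) (len _ Pv') erefl.
have [nw _] := face_midpoint (len' _ Pw) (len' _ Pw') erefl.
exists n; split; split=> //; rewrite ?nv ?nw //; [by exists v|by exists w].
Qed.

Lemma vertices_vert (a : V) : vertices P (val a).
Proof.
case: a => a /=; rewrite /vert; have [fP|nfP] := pselect (finite_set (vertices P)).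
  by rewrite in_fset_set // => /set_mem.
by rewrite /fset_set; case: pselect.
Qed.

Lemma vertices_sub (v : 'rV[R]_3) : vertices P v -> P v.
Proof. by move=> [n [c [_ /seteqP[/(_ v erefl)[]]]]]. Qed.

Lemma boundary_subproof z : boundary_fun z \in chain1_pred.
Proof.
case: z => z zP; rewrite /boundary_fun /=.
have /asboolP[z1 z2 z3] := zP; apply/asboolP.
have rev a b : boundary_fun (Chain2 zP) (b, a) = - boundary_fun (Chain2 zP) (a, b).
  rewrite !ffunE /= -sumrN.
  rewrite (reindex (fun f : V * V => (f.2, f.1))) /=; last first.
    by exists (fun f : V * V => (f.2, f.1)) => -[].
  by apply: eq_bigr => -[c d] _ /=; rewrite -z3 z2 z2 z2.
split=> // a b zab.
have aNb : val a <> val b.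
  move=> /val_inj ab; move: zab; rewrite -ab.
  have := rev a a; lra.
have Pv c : P (val c) := vertices_sub (vertices_vert c).
have [[c d] _ /z1[_ _ _ m]] : exists2 f : V * V, true & z (a, b, f.1, f.2) != 0.
  apply: contrapT => nz; move: zab; rewrite ffunE big1 ?eqxx // => f _.
  by apply/eqP/negPn/negP => zf; apply: nz; exists f.
by split; [exact: vertices_vert..|exact: aNb|exact: antipodal_corners m].
Qed.

Definition boundary (z : chain2) : chain1 := Chain1 (boundary_subproof z).

Lemma boundary_is_linear : linear boundary.
Proof.
move=> k x y; apply/val_inj/ffunP => e /=; rewrite !ffunE /=.
rewrite scaler_sumr -big_split /=; apply: eq_bigr => f _.
by rewrite !ffunE.
Qed.

HB.instance Definition _ :=
  GRing.isLinear.Build rat chain2 chain1 *:%R boundary boundary_is_linear.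

Definition belt_pred : {pred chain2} := [pred z : chain2 | boundary z == 0].

Lemma belt_closed : submod_closed belt_pred.
Proof.
split=> [|k x y]; rewrite !inE ?linear0 // => /eqP bx /eqP by_.
by rewrite boundary_is_linear bx by_ scaler0 addr0.
Qed.

HB.instance Definition _ :=
  GRing.isSubmodClosed.Build rat chain2 belt_pred belt_closed.

Record belt := Belt { belt_val :> chain2; _ : belt_val \in belt_pred }.
HB.instance Definition _ := [isSub for belt_val].
HB.instance Definition _ := [Choice of belt by <:].
HB.instance Definition _ := [SubChoice_isSubLmodule of belt by <:].

End Chains.

Section Pyramid.
Variables (R : realType) (k : nat).
Implicit Type p : 'I_k -> 'rV[R]_2.

(* A planar polygon is given by the cyclic sequence p of its vertices; the i-th
   edge joins p i to p (ordS i). *)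
Definition edge_vec p (i : 'I_k) : 'rV[R]_2 := p (ordS i) - p i.

Definition cross (u v : 'rV[R]_2) : R := u 0 0 * v 0 1 - u 0 1 * v 0 0.

(* Convex, listed counterclockwise: the polygon lies to the left of each of its
   edges and has an interior. Angles equal to pi are allowed. *)
Definition convex_polygon p : Prop :=
  [/\ injective p,
      forall i j, 0 <= cross (edge_vec p i) (p j - p i)
    & exists i j, 0 < cross (edge_vec p i) (p j - p i)].

Definition parallel_edges p (i j : 'I_k) : bool :=
  (edge_vec p i == edge_vec p j)%MS.

(* Adjacent edges share a vertex, so they are collinear iff parallel. *)
Definition no_collinear_adjacent_edges p : Prop :=
  forall i, ~~ parallel_edges p i (ordS i).

Definition parallel_pair p : pred {set 'I_k} :=
  [pred s | [exists i, exists j,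
     [&& i != j, s == [set i; j]%SET & parallel_edges p i j]]].

(* The rigid map x |-> x *m A + b places the plane of the polygon in 3-space. *)
Definition isometric_placement (A : 'M[R]_(2, 3)) : Prop := A *m A^T = 1%:M.

Definition place (A : 'M[R]_(2, 3)) (b : 'rV[R]_3) (x : 'rV[R]_2) : 'rV[R]_3 :=
  x *m A + b.

Definition pyramid p (A : 'M[R]_(2, 3)) (b apex : 'rV[R]_3) : set 'rV[R]_3 :=
  hull (place A b @` hull (range p) `|` [set apex]).

End Pyramid.

(* Main.v *)
Require Import Defs.
From HB Require Import structures.
From mathcomp Require Import all_boot all_order all_algebra finmap.
From mathcomp Require Import all_classical all_reals interval_inference convex.
From mathcomp Require Import ring lra zify.

(* A square is attached along v - w - v' - w' - v for edges v v' and w w', so a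
   2-chain is an antisymmetric pairing G on the oriented edges of the pyramid,
   and its boundary is the image of G under the tensor square of the boundary of
   edges. The squares are: two distinct parallel base edges, or a base edge i
   and the lateral edge through a vertex a of Q furthest from edge i.

   Let G be a belt. The boundary coefficients at the lateral edges say that the
   sum over a of G(base i, lateral a) does not depend on i. Pairing the boundary
   with the 1-cochain [v < w] for the cyclic order cut at one place, the apex
   last, kills the squares on two base edges and leaves -2 times that sum, so
   the sum is 0. If edge i has no parallel edge, there is only one such a and
   G(base i, lateral a) = 0. If j is parallel to i, then a is j or j + 1 and one
   coefficient, G(base i, lateral j), is free; likewise with i and j exchanged.
   These two numbers determine G: a belt for which they all vanish only involves
   pairs of base edges, and then its second difference vanishes on the cyclic
   grid, so it is constant along the rows and is 0 on the diagonal.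

   Conversely the wedge of base i with the triangle (lateral j) -
   (lateral j+1) - (base j) is a belt, because that triangle is a cycle. *)

Set Implicit Arguments.
Unset Strict Implicit.
Unset Printing Implicit Defensive.

Import Order.TTheory GRing.Theory Num.Theory.
Local Open Scope classical_set_scope.
Local Open Scope ring_scope.

(** * Antisymmetric pairings on the edges of a pyramid *)

Lemma sum_delta (T : finType) (g : T -> rat) a :
  \sum_v g v * (v == a)%:R = g a.
Proof.
rewrite (bigD1 a) //= eqxx mulr1 big1 ?addr0 // => v /negPf->.
by rewrite mulr0.
Qed.

(** Every index is reached from 0 by successors. This turns local equations between neighbouring
    edges into statements about whole rows. *)
Lemma ordS_const (k : nat) (T : Type) (f : 'I_k -> T) :
  (forall i, f (ordS i) = f i) -> forall i j, f i = f j.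
Proof.
move=> fS; suff f0 m (mk : (m < k)%N) (k0 : (0 < k)%N) :
    f (Ordinal mk) = f (Ordinal k0).
  by move=> [i ik] [j jk]; rewrite !(f0 _ _ (leq_ltn_trans (leq0n i) ik)).
elim: m mk => [|m IH] mk; first by rewrite (bool_irrelevance mk k0).
rewrite -(IH (ltnW mk)) -[RHS]fS; congr f.
by apply: val_inj; rewrite /= modn_small.
Qed.

Section PyramidChains.
Variable k : nat.

(* [inl i] is the base edge from p_i to p_(i+1), [inr a] the lateral edge from
   p_a to the apex, which is the vertex [None]. *)
Definition src (e : 'I_k + 'I_k) : option 'I_k :=
  match e with inl i => Some i | inr a => Some a end.
Definition tgt (e : 'I_k + 'I_k) : option 'I_k :=
  match e with inl i => Some (ordS i) | inr a => None end.

(** The oriented edge [e] as an elementary antisymmetric 1-chain. *)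
Definition edge_sign (e : 'I_k + 'I_k) (v w : option 'I_k) : rat :=
  ((v == src e) && (w == tgt e))%:R - ((v == tgt e) && (w == src e))%:R.

(** Minus the usual boundary of [e]; the sign cancels when two edges are tensored. *)
Definition endpoint_sign (e : 'I_k + 'I_k) (v : option 'I_k) : rat :=
  (v == src e)%:R - (v == tgt e)%:R.

Lemma sum_edge_sign e v : \sum_w edge_sign e v w = endpoint_sign e v.
Proof.
under eq_bigr do rewrite /edge_sign -!mulnb !natrM.
by rewrite sumrB !(sum_delta (fun=> _)).
Qed.

Lemma edge_signN e v w : edge_sign e w v = - edge_sign e v w.
Proof. by rewrite /edge_sign opprB ![(w == _) && _]andbC. Qed.

(** With B the vertex-edge incidence matrix, this is an entry of B G B^T. *)
Definition pair_boundary (G : 'I_k + 'I_k -> 'I_k + 'I_k -> rat) v w : rat :=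
  \sum_e endpoint_sign e v * \sum_f endpoint_sign f w * G e f.

Definition joins (e : 'I_k + 'I_k) (v w : option 'I_k) : Prop :=
  (v = src e /\ w = tgt e) \/ (v = tgt e /\ w = src e).

Lemma edge_sign_joins e v w : edge_sign e v w != 0 -> joins e v w.
Proof.
rewrite /edge_sign; have [/andP[/eqP-> /eqP->] _|_] := boolP (_ && _); first by left.
have [/andP[/eqP-> /eqP->] _|_] := boolP (_ && _); first by right.
by rewrite subrr eqxx.
Qed.

(** In the four-cycle v - w - v' - w' the edge [e] takes the first and third corners and [f] the
    other two; the signs record the direction of each. *)
Definition pair_chain (G : 'I_k + 'I_k -> 'I_k + 'I_k -> rat) v w v' w' : rat :=
  \sum_e \sum_f edge_sign e v v' * edge_sign f w w' * G e f.

Lemma pair_chain_neq0 G v w v' w' : pair_chain G v w v' w' != 0 ->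
  exists e f, [/\ joins e v v', joins f w w' & G e f != 0].
Proof.
move=> z0; apply: contrapT => nex; move/eqP: z0; apply.
rewrite /pair_chain big1 // => e _; rewrite big1 // => f _.
apply/eqP; apply: contraT; rewrite !mulf_eq0 !negb_or => /andP[/andP[ve wf] Gef].
by case: nex; exists e, f; split=> //; exact: edge_sign_joins.
Qed.

Lemma pair_chain_rev G v w v' w' : pair_chain G v w' v' w = - pair_chain G v w v' w'.
Proof.
rewrite /pair_chain -sumrN; apply: eq_bigr => e _; rewrite -sumrN; apply: eq_bigr => f _.
by rewrite (edge_signN f w w') mulrN mulNr.
Qed.

(** A rotation exchanges the two edges and reverses one of them; the two sign changes cancel. *)
Lemma pair_chain_rot G v w v' w' : (forall e f, G f e = - G e f) ->
  pair_chain G w v' w' v = pair_chain G v w v' w'.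
Proof.
move=> GC; rewrite /pair_chain exchange_big; apply: eq_bigr => e _; apply: eq_bigr => f _.
by rewrite (edge_signN e v v') (GC e f); ring.
Qed.

Lemma sum_pair_chain G v w :
  \sum_v' \sum_w' pair_chain G v w v' w' = pair_boundary G v w.
Proof.
rewrite /pair_boundary; under eq_bigr do rewrite exchange_big.
rewrite exchange_big; apply: eq_bigr => e _.
rewrite -sum_edge_sign mulr_suml; apply: eq_bigr => v' _.
rewrite exchange_big mulr_sumr; apply: eq_bigr => f _.
by rewrite -sum_edge_sign mulr_suml mulr_sumr; apply: eq_bigr => w' _; rewrite mulrA.
Qed.

Hypothesis ordS_neq : forall i : 'I_k, ordS i != i.
Hypothesis ordS2_neq : forall i : 'I_k, ordS (ordS i) != i.

(** Only two base edges running in opposite directions between the same ends could conflict, and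
    these would form a cycle of length two. *)
Lemma joins_inj e e' v w : joins e v w -> joins e' v w -> e = e'.
Proof.
case: e e' => [i|a] [j|b] [[-> ->]|[-> ->]] [[]|[]] //= E F; move: E F; last first.
- by move=> _ [->].
- by move=> [->].
- by move=> _ [->].
- by move=> [E] [F]; have := ordS2_neq i; rewrite E -F eqxx.
- by move=> [E] [F]; have := ordS2_neq j; rewrite -E F eqxx.
- by move=> [->].
Qed.

Lemma edge_sign_src e : edge_sign e (src e) (tgt e) = 1.
Proof.
rewrite /edge_sign !eqxx /=; case: e => [i|a] //=.
by rewrite !(inj_eq Some_inj) (negPf (ordS_neq i)) andbF subr0.
Qed.

Lemma pair_chain_joins G e f v w v' w' : joins e v v' -> joins f w w' ->
  pair_chain G v w v' w' = edge_sign e v v' * edge_sign f w w' * G e f.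
Proof.
move=> ev fw; rewrite /pair_chain (bigD1 e) //= [X in _ + X]big1 => [|e' e'e]; last first.
  rewrite big1 // => f' _; have [->|/edge_sign_joins e'v] := eqVneq (edge_sign e' v v') 0.
    by rewrite !mul0r.
  by rewrite (joins_inj e'v ev) eqxx in e'e.
rewrite addr0 (bigD1 f) //= big1 ?addr0 // => f' f'f.
have [->|/edge_sign_joins f'w] := eqVneq (edge_sign f' w w') 0.
  by rewrite mulr0 mul0r.
by rewrite (joins_inj f'w fw) eqxx in f'f.
Qed.

Lemma sum_endpoint_sign (g : option 'I_k -> rat) e :
  \sum_v g v * endpoint_sign e v = g (src e) - g (tgt e).
Proof.
by under eq_bigr do rewrite mulrBr; rewrite sumrB !sum_delta.
Qed.

Lemma sum_endpoint_Some (g : 'I_k + 'I_k -> rat) v :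
  \sum_e endpoint_sign e (Some v) * g e =
  g (inl v) - g (inl (ord_pred v)) + g (inr v).
Proof.
rewrite big_sumType /=; congr (_ + _); last first.
  rewrite -[RHS](sum_delta (fun a => g (inr a))); apply: eq_bigr => a _.
  by rewrite /endpoint_sign /= subr0 mulrC (inj_eq Some_inj) eq_sym.
rewrite -(sum_delta (fun i => g (inl i)) v).
rewrite -(sum_delta (fun i => g (inl i)) (ord_pred v)) -sumrB.
apply: eq_bigr => i _; rewrite /endpoint_sign /= !(inj_eq Some_inj) mulrC mulrBr.
by rewrite -[i == ord_pred v](inj_eq (@ordS_inj k)) ord_predK !(eq_sym v).
Qed.

Lemma sum_endpoint_None (g : 'I_k + 'I_k -> rat) :
  \sum_e endpoint_sign e None * g e = - \sum_a g (inr a).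
Proof.
rewrite big_sumType /= big1 ?add0r => [|i _]; last first.
  by rewrite /endpoint_sign /= subr0 mul0r.
by rewrite -sumrN; apply: eq_bigr => a _; rewrite /endpoint_sign /= sub0r mulN1r.
Qed.

(** Summation by parts in both variables: the boundary moves from [G] to the cochain [c]. *)
Lemma sum_pair_boundary (c : option 'I_k -> option 'I_k -> rat) G :
  \sum_v \sum_w c v w * pair_boundary G v w =
  \sum_e \sum_f G e f * (c (src e) (src f) - c (src e) (tgt f)
                         - (c (tgt e) (src f) - c (tgt e) (tgt f))).
Proof.
rewrite (eq_bigr (fun v => \sum_e endpoint_sign e v *
    \sum_f G e f * (c v (src f) - c v (tgt f)))) => [|v _]; last first.
  under eq_bigr do rewrite mulr_sumr.
  rewrite exchange_big /=; apply: eq_bigr => e _.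
  rewrite (eq_bigr (fun w => endpoint_sign e v * \sum_f c v w * endpoint_sign f w * G e f)).
    rewrite -mulr_sumr exchange_big /=; congr (_ * _); apply: eq_bigr => f _.
    by rewrite -mulr_suml sum_endpoint_sign mulrC.
  move=> w _; rewrite mulrCA; congr (_ * _); rewrite mulr_sumr.
  by apply: eq_bigr => f _; rewrite mulrA.
rewrite exchange_big /=; apply: eq_bigr => e _.
under eq_bigr do rewrite mulrC mulr_suml.
rewrite exchange_big /=; apply: eq_bigr => f _.
under eq_bigr do rewrite -mulrA.
rewrite -mulr_sumr; congr (_ * _).
exact: (sum_endpoint_sign (fun v => c v (src f) - c v (tgt f))).
Qed.

(** * The order cochain *)

Definition vertex_rank (v : option 'I_k) : nat := if v is Some i then i else k.

Definition ascent (v w : option 'I_k) : rat := (vertex_rank v < vertex_rank w)%N%:R.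

(** The coboundary of [ascent] on the square of [e] and [f], hence the weight of [G e f] after
    summation by parts. *)
Definition ascent_sum e f : rat :=
  ascent (src e) (src f) - ascent (src e) (tgt f)
  - (ascent (tgt e) (src f) - ascent (tgt e) (tgt f)).

Lemma modS_ord (l : 'I_k) : (l.+1 %% k = if (l.+1 < k)%N then l.+1 else 0)%N.
Proof.
case: ifP => lk; first by rewrite modn_small.
have -> : l.+1 = k by have := ltn_ord l; lia.
exact: modnn.
Qed.

(** At most one of the two edges crosses the cut. The ends of the other have consecutive ranks, so
    they compare alike with both ends of the first, which is disjoint from it, and the terms cancel
    in pairs. *)
Lemma ascent_sum_base i j :
  i != j -> j != ordS i -> i != ordS j -> ascent_sum (inl i) (inl j) = 0.
Proof.
have alt (a b c d : nat) : (a + d = b + c)%N -> a%:R - b%:R - (c%:R - d%:R) = 0 :> rat.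
  by move=> /(congr1 (fun n => n%:R : rat)); rewrite !natrD; lra.
rewrite -!val_eqE /ascent_sum /ascent /= !modS_ord => ij ji ij'; apply: alt.
by move: (ltn_ord i) (ltn_ord j) ij ji ij'; do 2 case: ifP => ?; lia.
Qed.

(** Away from the cut, both ends of the base edge compare alike with [a] and with the apex. The edge
    across the cut has [a] strictly between its ends in rank, which leaves one unmatched term. *)
Lemma ascent_sum_lateral i a : a != i -> a != ordS i ->
  ascent_sum (inl i) (inr a) = - (i.+1 == k)%:R /\
  ascent_sum (inr a) (inl i) = (i.+1 == k)%:R.
Proof.
have := ltn_ord i; have := ltn_ord a.
rewrite -!val_eqE /ascent_sum /ascent /= !modS_ord => ak ik ai.
case: ifP => Sik aSi.
  have -> : (i.+1 == k) = false by lia.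
  have -> : (i.+1 < a)%N = (i < a)%N by lia.
  have -> : (a < i.+1)%N = (a < i)%N by lia.
  have -> : (k < i)%N = false by lia.
  have -> : (k < i.+1)%N = false by lia.
  by rewrite ik Sik /= ?mulr1n ?mulr0n; split; ring.
have -> : (i.+1 == k) = true by lia.
have -> : (a < i)%N by lia.
have -> : (i < a)%N = false by lia.
have -> : (0 < a)%N by lia.
have -> : (k < i)%N = false by lia.
by rewrite ik (leq_ltn_trans _ ik) // ltn0 /= ?mulr1n ?mulr0n; split; ring.
Qed.

(** * Belts with zero coordinates, for abstract relations of parallelism and of furthest vertices *)

Section Injectivity.
Variables (par anti : rel 'I_k).
Hypothesis par_ordS : forall i, ~~ par i (ordS i).
Hypothesis par_sym : symmetric par.
Hypothesis anti_ends : forall i a, anti i a -> a != i /\ a != ordS i.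
Hypothesis anti_par : forall i a a', anti i a -> anti i a' -> a != a' ->
  [\/ [/\ i != a, par i a & a' = ordS a] | [/\ i != a', par i a' & a = ordS a']].

Variable G : 'I_k + 'I_k -> 'I_k + 'I_k -> rat.
Hypothesis G_anti : forall e f, G f e = - G e f.
Hypothesis G_base : forall i j, G (inl i) (inl j) != 0 -> i != j /\ par i j.
Hypothesis G_mixed : forall i a, G (inl i) (inr a) != 0 -> anti i a.
Hypothesis G_lateral : forall a a', G (inr a) (inr a') = 0.
Hypothesis dG : forall v w, pair_boundary G v w = 0.

Lemma pair_sum_const i j :
  \sum_a G (inl i) (inr a) = \sum_a G (inl j) (inr a).
Proof.
apply: (ordS_const (f := fun i => \sum_a G (inl i) (inr a))) => {}i.
(* At the pair (vertex i + 1, apex) the terms on two lateral edges vanish, which leaves the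
   difference of two neighbouring row sums. *)
have := dG (Some (ordS i)) None; rewrite /pair_boundary.
under eq_bigr do rewrite sum_endpoint_None.
rewrite sum_endpoint_Some ordSK [X in _ - X](big1 _ _ _ (fun a _ => G_lateral _ a)).
by lra.
Qed.

Lemma pair_sum0 i : \sum_a G (inl i) (inr a) = 0.
Proof.
(* [l] will be the base edge across the cut, the only one with nonzero weights against disjoint
   lateral edges. *)
have lk : (k.-1 < k)%N by have := ltn_ord i; lia.
rewrite (pair_sum_const i (Ordinal lk)); set l := Ordinal lk.
have lE (j : 'I_k) : (j.+1 == k) = (j == l).
  by rewrite -val_eqE /=; have := ltn_ord j; lia.
have : \sum_v \sum_w ascent v w * pair_boundary G v w = 0.
  by rewrite big1 // => v _; rewrite big1 // => w _; rewrite dG mulr0.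
rewrite sum_pair_boundary big_sumType /=.
have -> : \sum_j \sum_f G (inl j) f * ascent_sum (inl j) f =
    - \sum_a G (inl l) (inr a).
  rewrite -[RHS](sum_delta (fun j => - \sum_a G (inl j) (inr a))).
  apply: eq_bigr => j _; rewrite big_sumType big1 => [|j' _] /=.
    rewrite add0r mulNr mulr_suml -sumrN; apply: eq_bigr => a _.
    have [->|/G_mixed/anti_ends[aj aSj]] := eqVneq (G (inl j) (inr a)) 0.
      by rewrite !mul0r oppr0.
    by rewrite (ascent_sum_lateral aj aSj).1 lE mulrN.
  have [->|/G_base[jj' pjj']] := eqVneq (G (inl j) (inl j')) 0; first by rewrite mul0r.
  rewrite ascent_sum_base ?mulr0 //; apply/eqP => E.
    by have := par_ordS j; rewrite -E pjj'.
  by have := par_ordS j'; rewrite -E par_sym pjj'.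
(* Here both [G] and the weight change sign, so this block repeats the previous contribution instead
   of cancelling it. *)
have -> : \sum_a \sum_f G (inr a) f * ascent_sum (inr a) f =
    - \sum_a G (inl l) (inr a).
  rewrite exchange_big big_sumType /= [X in _ + X]big1 ?addr0 => [|b _]; last first.
    by rewrite big1 // => a _; rewrite G_lateral mul0r.
  rewrite -[RHS](sum_delta (fun j => - \sum_a G (inl j) (inr a))).
  apply: eq_bigr => j _; rewrite mulNr mulr_suml -sumrN; apply: eq_bigr => a _.
  rewrite G_anti; have [->|/G_mixed/anti_ends[aj aSj]] := eqVneq (G (inl j) (inr a)) 0.
    by rewrite oppr0 !mul0r oppr0.
  by rewrite (ascent_sum_lateral aj aSj).2 lE mulNr.
by lra.
Qed.

Hypothesis G_coord : forall i j, i != j -> par i j -> G (inl i) (inr j) = 0.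

(** The row sum is 0, so a nonzero entry forces a second one in its row. Edge i then has two
    furthest vertices, the ends of a parallel edge j, and the entry at vertex j is zero by
    [G_coord]. *)
Lemma mixed_pair0 i a : G (inl i) (inr a) = 0.
Proof.
apply/eqP; apply: contraT => Ga.
have [a' aa' Ga'] : exists2 a', a != a' & G (inl i) (inr a') != 0.
  apply: contrapT => Ga'; have := pair_sum0 i.
  rewrite (bigD1 a) //= big1 ?addr0 => [G0|a' aa']; first by rewrite G0 eqxx in Ga.
  by apply/eqP; apply: contraT => Gia'; case: Ga'; exists a'; rewrite // eq_sym.
case: (anti_par (G_mixed Ga) (G_mixed Ga') aa') => -[ia pia _].
  by rewrite G_coord ?eqxx in Ga.
by rewrite (G_coord ia pia) eqxx in Ga'.
Qed.

Lemma base_pair0 i j : G (inl i) (inl j) = 0.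
Proof.
(* Once the mixed terms are gone, the boundary at two base vertices is a mixed second difference. *)
have Gd v b : G (inl v) (inl b) - G (inl v) (inl (ord_pred b))
    - (G (inl (ord_pred v)) (inl b) - G (inl (ord_pred v)) (inl (ord_pred b))) = 0.
  rewrite -(dG (Some v) (Some b)) /pair_boundary sum_endpoint_Some.
  rewrite !sum_endpoint_Some !mixed_pair0 G_lateral.
  by rewrite !(G_anti (inl _) (inr v)) !mixed_pair0; ring.
have G0 v : G (inl v) (inl v) = 0 by have := G_anti (inl v) (inl v); lra.
(* The increment along a row does not depend on the row; on row b it is the entry of the adjacent,
   hence nonparallel, edges b and b + 1. *)
have GS v b : G (inl v) (inl (ordS b)) - G (inl v) (inl b) = 0.
  rewrite (ordS_const (f := fun v => G (inl v) (inl (ordS b)) - G (inl v) (inl b)) _ v b).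
    rewrite G0 subr0; apply/eqP; apply: contraT => /G_base[_ pb].
    by have := par_ordS b; rewrite pb.
  by move=> u; have := Gd (ordS u) (ordS b); rewrite !ordSK; lra.
rewrite (ordS_const (f := fun b => G (inl i) (inl b)) _ j i) // => b.
by have := GS i b; lra.
Qed.

Lemma pairing0 e f : G e f = 0.
Proof.
case: e f => [i|a] [j|a'].
- exact: base_pair0.
- exact: mixed_pair0.
- by rewrite G_anti mixed_pair0 oppr0.
- exact: G_lateral.
Qed.

End Injectivity.

(* The sum of w i j times the wedge of the base edge i with the triangle
   (lateral j) - (lateral j+1) - (base j), which is a cycle. *)
Definition triangle_pairing (w : 'I_k -> 'I_k -> rat) (e f : 'I_k + 'I_k) : rat :=
  match e, f with
  | inl i, inl j => w j i - w i j
  | inl i, inr a => w i a - w i (ord_pred a)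
  | inr a, inl i => w i (ord_pred a) - w i a
  | inr _, inr _ => 0
  end.

Lemma triangle_pairingC w e f : triangle_pairing w f e = - triangle_pairing w e f.
Proof. by case: e f => [i|a] [j|b] /=; ring. Qed.

Lemma boundary_triangle_pairing w v u : pair_boundary (triangle_pairing w) v u = 0.
Proof.
have tele i : \sum_a (w i a - w i (ord_pred a)) = 0.
  by rewrite sumrB [X in X - _](reindex_inj (@ord_pred_inj k)) subrr.
have teleN i : \sum_a (w i (ord_pred a) - w i a) = 0.
  by under eq_bigr do rewrite -opprB; rewrite sumrN tele oppr0.
rewrite /pair_boundary; case: u => [b|].
  under eq_bigr do rewrite sum_endpoint_Some.
  case: v => [v|]; first by rewrite sum_endpoint_Some /=; ring.
  rewrite sum_endpoint_None /=; under eq_bigr do rewrite addr0.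
  by rewrite sumrB !teleN subrr oppr0.
under eq_bigr do rewrite sum_endpoint_None.
case: v => [v|]; rewrite ?sum_endpoint_Some ?sum_endpoint_None /= ?tele !big1_eq.
  by ring.
by rewrite oppr0.
Qed.

End PyramidChains.

(** * Convex polygons *)

Section PlanarCross.
Variable R : realType.
Implicit Types (u v x y : 'rV[R]_2).

Lemma crossBr u x y : cross u (x - y) = cross u x - cross u y.
Proof. by rewrite /cross !mxE; ring. Qed.

Lemma crossNl u x : cross (- u) x = - cross u x.
Proof. by rewrite /cross !mxE; ring. Qed.

Lemma crossDl u v x : cross (u + v) x = cross u x + cross v x.
Proof. by rewrite /cross !mxE; ring. Qed.

Lemma crossZl a u x : cross (a *: u) x = a * cross u x.
Proof. by rewrite /cross !mxE; ring. Qed.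

Lemma crossC u v : cross v u = - cross u v.
Proof. by rewrite /cross; ring. Qed.

Lemma cross0l x : cross 0 x = 0.
Proof. by rewrite /cross !mxE; ring. Qed.

Lemma crossvv u : cross u u = 0.
Proof. by rewrite /cross; ring. Qed.

Lemma dotBr d (u x y : 'rV[R]_d) : dot u (x - y) = dot u x - dot u y.
Proof. by rewrite /dot -sumrB; apply: eq_bigr => i _; rewrite !mxE mulrBr. Qed.

Lemma dotvv_gt0 d (u : 'rV[R]_d) : u != 0 -> 0 < dot u u.
Proof.
move=> u0; have sq i : 0 <= u 0 i * u 0 i by rewrite -expr2 sqr_ge0.
rewrite lt_neqAle sumr_ge0 // andbT eq_sym; apply: contra u0.
rewrite psumr_eq0 // => /allP uu; apply/eqP/rowP => i; rewrite mxE.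
by have := uu i (mem_index_enum i); rewrite mulf_eq0 orbb => /eqP.
Qed.

Lemma dot2E u v : dot u v = u 0 0 * v 0 0 + u 0 1 * v 0 1.
Proof.
rewrite /dot big_ord_recl big_ord1; congr (_ + u _ _ * v _ _); exact: val_inj.
Qed.

(** The right-hand side is the determinant of the coordinates of x and y along [u] and its quarter
    turn. *)
Lemma dot_cross u x y :
  dot u u * cross x y = dot u x * cross u y - dot u y * cross u x.
Proof. by rewrite !dot2E /cross; ring. Qed.

Lemma cross_colinear u x y : u != 0 -> cross u x = 0 -> cross u y = 0 -> cross x y = 0.
Proof.
move=> /dotvv_gt0 u0 ux uy; have := dot_cross u x y; rewrite ux uy !mulr0 subrr.
by move/eqP; rewrite mulf_eq0 gt_eqF //= => /eqP.
Qed.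


Lemma cross_eq0P u x : u != 0 -> cross u x = 0 -> x = (dot u x / dot u u) *: u.
Proof.
move=> /dotvv_gt0/lt0r_neq0 u0 ux; apply: (scalerI u0).
rewrite scalerA mulrCA divff // mulr1; apply/rowP => i; rewrite !mxE !dot2E.
have [->|->] : i = 0 \/ i = 1.
  by case: i => [[|[|//]]] ?; [left|right]; apply: val_inj.
- by apply/eqP; rewrite -subr_eq0 -(mulr0 (- u 0 1)) -ux /cross; apply/eqP; ring.
- by apply/eqP; rewrite -subr_eq0 -(mulr0 (u 0 0)) -ux /cross; apply/eqP; ring.
Qed.

End PlanarCross.

(** * Strictly convex polygons and their supporting lines *)

Section Polygon.
Variables (R : realType) (k : nat) (p : 'I_k -> 'rV[R]_2).
Hypothesis p_inj : injective p.
Hypothesis p_left : forall i j, 0 <= cross (edge_vec p i) (p j - p i).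
Hypothesis p_strict : no_collinear_adjacent_edges p.
Implicit Types (u : 'rV[R]_2) (i j a : 'I_k).

Lemma parallel_edges_refl i : parallel_edges p i i.
Proof. by rewrite /parallel_edges submx_refl. Qed.

Lemma parallel_edges_sym : symmetric (parallel_edges p).
Proof. by move=> i j; rewrite /parallel_edges andbC. Qed.

Lemma parallel_edges_trans : transitive (parallel_edges p).
Proof.
move=> j i l /andP[ij ji] /andP[jl lj].
by rewrite /parallel_edges (submx_trans ij jl) (submx_trans lj ji).
Qed.

Lemma ordS_neq i : ordS i != i.
Proof.
by apply/eqP => Si; have := p_strict i; rewrite Si parallel_edges_refl.
Qed.

Lemma edge_vec_neq0 i : edge_vec p i != 0.
Proof.
by rewrite subr_eq0; apply: contra (ordS_neq i) => /eqP/p_inj->.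
Qed.

Lemma parallel_edgesE i j :
  parallel_edges p i j = (cross (edge_vec p i) (edge_vec p j) == 0).
Proof.
apply/idP/eqP => [/andP[_ /sub_rVP[a ->]]|ij].
  by rewrite crossC crossZl crossvv mulr0 oppr0.
apply/andP; split; apply/sub_rVP; eexists; apply: cross_eq0P; rewrite ?edge_vec_neq0 //.
by rewrite crossC ij oppr0.
Qed.

Lemma ordS2_neq i : ordS (ordS i) != i.
Proof.
apply/eqP => SSi; have := p_strict i; rewrite parallel_edgesE.
have -> : edge_vec p (ordS i) = - edge_vec p i by rewrite /edge_vec SSi opprB.
by rewrite crossC crossNl crossvv !oppr0 eqxx.
Qed.

(** Level sets of [cross u] are lines directed by [u], so the adjacent edges i and i + 1 would be
    parallel. *)
Lemma not_three_aligned u i : u != 0 -> cross u (p (ordS i)) = cross u (p i) ->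
  cross u (p (ordS (ordS i))) = cross u (p (ordS i)) -> False.
Proof.
move=> u0 e1 e2; have := p_strict i; rewrite parallel_edgesE.
by rewrite (cross_colinear u0) ?eqxx // /edge_vec crossBr ?e2 ?e1 subrr.
Qed.

Lemma cross_not_const u i : u != 0 -> exists j, cross u (p j) != cross u (p i).
Proof.
move=> u0; apply: contrapT => nex.
have E j : cross u (p j) = cross u (p i).
  by apply/eqP; apply: contraT => Ej; case: nex; exists j.
by apply: (not_three_aligned (i := i) u0); rewrite !E.
Qed.

Lemma edge_end i : cross (edge_vec p i) (p (ordS i)) = cross (edge_vec p i) (p i).
Proof. by apply/eqP; rewrite -subr_eq0 -crossBr crossvv. Qed.

Section SupportLine.
Variables (u : 'rV[R]_2) (c : R).
Hypothesis u_neq0 : u != 0.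
Hypothesis c_min : forall m, c <= cross u (p m).

(* At an end of the supporting line the polygon lies left of an edge that
   leaves the line, so a vertex that is not the last one on the line has its
   successor on the line. *)
Lemma support_next a m : cross u (p a) = c -> cross u (p m) = c ->
  dot u (p a) < dot u (p m) -> cross u (p (ordS a)) = c.
Proof.
move=> ac mc am; apply/eqP; rewrite eq_le c_min andbT.
have := dot_cross u (edge_vec p a) (p m - p a).
rewrite (crossBr u (p m)) (crossBr u (p (ordS a))) ac mc subrr mulr0 sub0r dotBr => E.
have := mulr_ge0 (ltW (dotvv_gt0 u_neq0)) (p_left a m); rewrite E => h.
rewrite leNgt; apply/negP => lt; move: h; apply/negP; rewrite -ltNge oppr_lt0.
by rewrite mulr_gt0 // subr_gt0.
Qed.

Lemma support_prev a m : cross u (p (ordS a)) = c -> cross u (p m) = c ->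
  dot u (p m) < dot u (p (ordS a)) -> cross u (p a) = c.
Proof.
move=> ac mc am; apply/eqP; rewrite eq_le c_min andbT.
have := dot_cross u (edge_vec p a) (p m - p (ordS a)).
rewrite (crossBr u (p m)) (crossBr u _ (p a)) ac mc subrr mulr0 sub0r dotBr => E.
have := p_left a m.
have -> : cross (edge_vec p a) (p m - p a) = cross (edge_vec p a) (p m - p (ordS a)).
  by rewrite !crossBr edge_end.
move/(mulr_ge0 (ltW (dotvv_gt0 u_neq0))); rewrite E => h.
rewrite leNgt; apply/negP => lt; move: h; apply/negP; rewrite -ltNge oppr_lt0.
by rewrite nmulr_rgt0 ?subr_lt0.
Qed.

(** Order i before j along the line. Then i + 1 is on the line too. If it comes before j, so is i +
    2; if it comes after j, then j - 1 and j + 1 are. Either way three successive vertices are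
    aligned. *)
Lemma support_consecutive i j : i != j -> cross u (p i) = c -> cross u (p j) = c ->
  j = ordS i \/ i = ordS j.
Proof.
move=> ij ic jc; wlog lt_ij : i j ij ic jc / dot u (p i) < dot u (p j).
  move=> H; have [lt|lt|E] := ltgtP (dot u (p i)) (dot u (p j)).
  - exact: H.
  - by case: (H j i) => //; [rewrite eq_sym|right|left].
  - move: ij; rewrite (_ : i = j) ?eqxx //; apply/esym/p_inj/eqP; rewrite -subr_eq0.
    by rewrite (cross_eq0P u_neq0 (x := p j - p i)) ?dotBr ?crossBr
      ?E ?ic ?jc ?subrr ?mul0r ?scale0r.
left; apply/eqP; apply: contraT => jSi.
have Sic := support_next ic jc lt_ij.
have aligned a : cross u (p a) = c -> cross u (p (ordS a)) = c ->
    cross u (p (ordS (ordS a))) = c -> False.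
  by move=> a1 a2 a3; apply: (not_three_aligned u_neq0 (i := a)); rewrite ?a1 ?a2 ?a3.
exfalso; have [lt|lt|E] := ltgtP (dot u (p (ordS i))) (dot u (p j)).
- exact: aligned ic Sic (support_next Sic jc lt).
- apply: (aligned (ord_pred j)); rewrite ?ord_predK //.
    by apply: (@support_prev _ i); rewrite ?ord_predK.
  exact: support_next jc Sic lt.
- move/eqP: jSi; apply; apply/p_inj/eqP; rewrite -subr_eq0.
  by rewrite (cross_eq0P u_neq0 (x := p j - _)) ?dotBr ?crossBr
    ?E ?Sic ?jc ?subrr ?mul0r ?scale0r.
Qed.

End SupportLine.

Lemma edge_line i m : cross (edge_vec p i) (p i) <= cross (edge_vec p i) (p m).
Proof. by have := p_left i m; rewrite crossBr subr_ge0. Qed.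

Lemma edge_line_strict i m : m != i -> m != ordS i ->
  cross (edge_vec p i) (p i) < cross (edge_vec p i) (p m).
Proof.
move=> mi mSi; rewrite lt_neqAle edge_line andbT; apply/negP => /eqP E.
have := support_consecutive (edge_vec_neq0 i) (edge_line i) mi (esym E) erefl.
case=> [iSm|mE]; last by rewrite mE eqxx in mSi.
apply: (not_three_aligned (i := m) (edge_vec_neq0 i)); rewrite -iSm //.
exact: edge_end.
Qed.

(** Take the sum of the two edge vectors at vertex i: both functionals are minimal there, and any
    other vertex is off at least one of the two edge lines. *)
Lemma vertex_support i : exists u, forall m, m != i -> cross u (p i) < cross u (p m).
Proof.
set h := ord_pred i; exists (edge_vec p h + edge_vec p i) => m mi.
have hi : cross (edge_vec p h) (p i) = cross (edge_vec p h) (p h).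
  by rewrite -[in LHS](ord_predK i) edge_end.
rewrite (crossDl _ _ (p i)) (crossDl _ _ (p m)) hi; have [->|mSi] := eqVneq m (ordS i).
  rewrite edge_end ltrD2r edge_line_strict // ?ord_predK ?ordS_neq //.
  by rewrite -{1}(ord_predK i) ordS2_neq.
by rewrite ler_ltD ?edge_line ?edge_line_strict.
Qed.

(** Up to a positive factor and a constant, [cross (edge_vec p i)] is the distance to the line of
    edge i, so these are the furthest vertices. *)
Definition antipodal_vertex i a : bool :=
  [forall m, cross (edge_vec p i) (p m) <= cross (edge_vec p i) (p a)].

Lemma antipodal_vertexP i a :
  reflect (forall m, cross (edge_vec p i) (p m) <= cross (edge_vec p i) (p a))
          (antipodal_vertex i a).
Proof. exact: forallP. Qed.

Lemma antipodal_vertex_gt i a : antipodal_vertex i a ->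
  cross (edge_vec p i) (p i) < cross (edge_vec p i) (p a).
Proof.
move=> /antipodal_vertexP ia; have [m mi] := cross_not_const i (edge_vec_neq0 i).
by apply: lt_le_trans (ia m); rewrite lt_neqAle eq_sym mi edge_line.
Qed.

Lemma antipodal_vertex_neq i a : antipodal_vertex i a -> a != i /\ a != ordS i.
Proof.
move=> /antipodal_vertex_gt ia; split; apply: contraTneq ia => ->.
  by rewrite ltxx.
by rewrite edge_end ltxx.
Qed.

(** Both vertices lie on the supporting line opposite to edge i, hence are consecutive, and the edge
    between them has the direction of that line. *)
Lemma antipodal_vertices_parallel i a a' :
  antipodal_vertex i a -> antipodal_vertex i a' -> a != a' ->
  [/\ i != a, parallel_edges p i a & a' = ordS a] \/
  [/\ i != a', parallel_edges p i a' & a = ordS a'].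
Proof.
move=> ia ia' aa'; have E : cross (edge_vec p i) (p a) = cross (edge_vec p i) (p a').
  by apply/eqP; rewrite eq_le !(antipodal_vertexP _ _ _).
have Nu : - edge_vec p i != 0 by rewrite oppr_eq0 edge_vec_neq0.
have Nc m : cross (- edge_vec p i) (p a) <= cross (- edge_vec p i) (p m).
  by rewrite !crossNl lerN2; exact: antipodal_vertexP.
have [ai _] := antipodal_vertex_neq ia; have [a'i _] := antipodal_vertex_neq ia'.
case: (support_consecutive Nu Nc aa' erefl); rewrite ?crossNl ?E // => aE.
  left; split; rewrite 1?eq_sym // parallel_edgesE crossBr -aE E subrr; exact: eqxx.
by right; split; rewrite 1?eq_sym // parallel_edgesE crossBr -aE E subrr eqxx.
Qed.

(** Write edge j as [l] times edge i. If [l] is negative, the polygon lies on the near side of edge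
    j. If [l] is positive, both edges lie on the same line, against strict convexity. *)
Lemma parallel_antipodal i j : i != j -> parallel_edges p i j ->
  antipodal_vertex i j /\ antipodal_vertex i (ordS j).
Proof.
move=> ij; rewrite parallel_edgesE => /eqP par.
have jS : cross (edge_vec p i) (p (ordS j)) = cross (edge_vec p i) (p j).
  by apply/eqP; rewrite -subr_eq0 -crossBr par.
suff ia : antipodal_vertex i j.
  by split=> //; apply/antipodal_vertexP => m; rewrite jS; exact/antipodal_vertexP.
have /cross_eq0P := par; move=> /(_ (edge_vec_neq0 i)); set l := _ / _ => jE.
have l0 : l != 0 by apply: contraTneq (edge_vec_neq0 j) => l0; rewrite jE l0 scale0r eqxx.
have le m : 0 <= l * (cross (edge_vec p i) (p m) - cross (edge_vec p i) (p j)).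
  by rewrite -crossBr -crossZl -jE; exact: p_left.
have [lt|gt] := ltP l 0.
  by apply/antipodal_vertexP => m; have := le m; rewrite nmulr_rge0 // subr_le0.
have {gt l0}gt : 0 < l by rewrite lt_neqAle eq_sym l0.
have E : cross (edge_vec p i) (p j) = cross (edge_vec p i) (p i).
  by apply/eqP; rewrite eq_le edge_line andbT; have := le i; rewrite pmulr_rge0 // subr_ge0.
exfalso; have [jSi|jSi] := eqVneq j (ordS i).
  by have := p_strict i; rewrite parallel_edgesE -jSi par eqxx.
by have := edge_line_strict (i := i) (m := j); rewrite eq_sym ij jSi E ltxx => /(_ isT isT).
Qed.

End Polygon.
(** * Supporting planes of the pyramid *)

Section ConvexHull.
Variables (R : realType) (d : nat).
Implicit Types (S : set 'rV[R]_d) (x y n : 'rV[R]_d).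

Lemma convex_setI01 S :
  (forall x y t, 0 < t -> t < 1 -> S x -> S y -> S (t *: x + (1 - t) *: y)) ->
  convex_set S.
Proof.
move=> SC; apply/convex_setW => x y; rewrite !inE => Sx Sy t t0 t1.
by rewrite inE; exact: SC.
Qed.

Lemma hull_convex S : convex_set (hull S).
Proof.
move=> x y t; rewrite !inE => Sx Sy M [cM SM].
by have := cM x y t; rewrite !inE; apply; [apply: Sx|apply: Sy].
Qed.

Lemma hull_min S M : convex_set M -> S `<=` M -> hull S `<=` M.
Proof. by move=> cM SM; exact: smallest_sub. Qed.

Lemma sub_hull S : S `<=` hull S.
Proof. exact: sub_gen_smallest. Qed.

Lemma hull_midpoint S x y : hull S x -> hull S y -> hull S (midpoint x y).
Proof.
move=> Sx Sy; have h0 : 0 <= 2^-1 :> R by lra.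
have h1 : 2^-1 <= 1 :> R by lra.
have := @hull_convex S x y (Itv01 h0 h1); rewrite !inE => /(_ Sx Sy).
rewrite /conv /= /unstable.onem /midpoint scalerDr.
by rewrite (_ : 1 - 2^-1 = 2^-1) //; lra.
Qed.

Lemma hull_nonempty S x : hull S x -> exists y, S y.
Proof.
apply: (hull_min (M := [set _ | exists y, S y])) => [|y Sy]; last by exists y.
exact: convex_setI01.
Qed.

Lemma hull1 x : hull [set x] = [set x].
Proof.
apply/seteqP; split; last exact: sub_hull.
apply: hull_min => //; apply: convex_setI01 => y z t _ _ /= -> ->.
by rewrite -scalerDl addrC subrK scale1r.
Qed.

Lemma dotZDr n x y (s t : R) : dot n (s *: x + t *: y) = s * dot n x + t * dot n y.
Proof.
by rewrite /dot !mulr_sumr -big_split /=; apply: eq_bigr => i _; rewrite !mxE; ring.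
Qed.

Lemma dotNl n x : dot (- n) x = - dot n x.
Proof. by rewrite /dot -sumrN; apply: eq_bigr => i _; rewrite !mxE mulNr. Qed.

Lemma dot0l x : dot 0 x = 0.
Proof. by rewrite /dot big1 // => i _; rewrite mxE mul0r. Qed.

Lemma hull_le S n c : (forall x, S x -> dot n x <= c) ->
  forall x, hull S x -> dot n x <= c.
Proof.
move=> Sc; apply: (hull_min (M := [set x | dot n x <= c])) => //.
apply: convex_setI01 => x y t t0 t1 /= xc yc; rewrite dotZDr; nra.
Qed.

Lemma hull_eq S n c : (forall x, S x -> dot n x = c) ->
  forall x, hull S x -> dot n x = c.
Proof.
move=> Sc; apply: (hull_min (M := [set x | dot n x = c])) => //.
apply: convex_setI01 => x y t t0 t1 /= xc yc; rewrite dotZDr xc yc; ring.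
Qed.

Lemma hull_face S n c : (forall x, S x -> dot n x <= c) ->
  [set x | hull S x /\ dot n x = c] = hull [set x | S x /\ dot n x = c].
Proof.
move=> Sc; apply/seteqP; split=> [x [Sx xc]|x].
  (* [M] is convex: a proper combination involving a point strictly below level c stays strictly
     below it. *)
  pose M := [set x | dot n x < c \/ dot n x = c /\ hull [set x | S x /\ dot n x = c] x].
  suff : M x by case=> [|[]//]; rewrite xc ltxx.
  apply: (hull_min (S := S)) => // [|{xc}x {}Sx]; last first.
    have := Sc x Sx; rewrite le_eqVlt => /orP[/eqP xc|]; last by left.
    by right; split=> //; apply: sub_hull.
  apply/convex_setW => y z; rewrite !inE => My Mz t t0 t1; rewrite inE.
  have le w : M w -> dot n w <= c by case=> [/ltW//|[->]].
  have yc := le _ My; have zc := le _ Mz.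
  have E : dot n (conv t y z) = t%:num * dot n y + (1 - t%:num) * dot n z.
    exact: dotZDr.
  case: My => [ylt|[yE hy]]; first by left; rewrite E; nra.
  case: Mz => [zlt|[zE hz]]; first by left; rewrite E; nra.
  right; split; first by rewrite E yE zE; ring.
  by have := @hull_convex [set x | S x /\ dot n x = c] y z t; rewrite !inE; apply.
move=> hx; split; last by apply: hull_eq hx => y [].
by apply: hull_min hx; [exact: hull_convex|move=> y [Sy _]; exact: sub_hull].
Qed.

End ConvexHull.

(** * Vertices, edges and antipodal edges of the pyramid *)

Section PyramidGeometry.
Variables (R : realType) (k : nat) (p : 'I_k -> 'rV[R]_2).
Variables (A : 'M[R]_(2, 3)) (b apex : 'rV[R]_3).
Hypothesis p_inj : injective p.
Hypothesis p_left : forall i j, 0 <= cross (edge_vec p i) (p j - p i).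
Hypothesis p_strict : no_collinear_adjacent_edges p.
Hypothesis A_isom : isometric_placement A.
Variable i0 : 'I_k.
Hypothesis apex_out : ~ range (place A b) apex.

Definition corner (v : option 'I_k) : 'rV[R]_3 :=
  if v is Some i then place A b (p i) else apex.

Local Notation P := (pyramid p A b apex).

Lemma pyramid_hull : P = hull (range corner).
Proof.
apply/seteqP; split; apply: hull_min; try exact: hull_convex.
  move=> x [[y hy <-{x}]|->]; last by apply: sub_hull; exists None.
  apply: (hull_min (M := place A b @^-1` hull (range corner))) hy.
    move=> {}y z t; rewrite !inE => hy hz.
    have := @hull_convex _ _ (range corner) (place A b y) (place A b z) t.
    rewrite !inE => /(_ hy hz); rewrite /conv /= /place mulmxDl -!scalemxAl.
    suff -> : forall s (v w : 'rV[R]_3), s *: (v + b) + unstable.onem s *: (w + b) =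
       s *: v + unstable.onem s *: w + b by [].
    move=> s v w; apply/rowP => i; rewrite !mxE /unstable.onem; ring.
  by move=> _ [i _ <-]; apply: sub_hull; exists (Some i).
move=> _ [[i|] _ <-] /=; apply: sub_hull; last by right.
by left; exists (p i) => //; apply: sub_hull; exists i.
Qed.

Lemma dotE d (u v : 'rV[R]_d) : dot u v = (u *m v^T) 0 0.
Proof. by rewrite mxE; apply: eq_bigr => i _; rewrite mxE. Qed.

(** Two axes of the base plane and the vector to the apex: a basis, so a linear form may be
    prescribed freely on the plane and at the apex. *)
Let frame : 'M[R]_3 := col_mx A (apex - b).

Lemma mulA_inj : injective (fun x : 'rV[R]_2 => x *m A).
Proof.
move=> x y /(congr1 (mulmx^~ A^T)); rewrite -!mulmxA.
by move: A_isom; rewrite /isometric_placement => ->; rewrite !mulmx1.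
Qed.

Lemma frame_unit : frame \in unitmx.
Proof.
rewrite -row_free_unit; apply: inj_row_free => v; rewrite -(@hsubmxK _ 1 2 1 v).
rewrite [_ *m _](@mul_row_col _ 1 2 1 3) [rsubmx _]mx11_scalar mul_scalar_mx.
set a := rsubmx _ 0 0; set w := lsubmx _ => E.
have [a0|a0] := eqVneq a 0.
  have -> : w = 0 by apply: mulA_inj; rewrite mul0mx -E a0 scale0r addr0.
  by rewrite a0 raddf0 row_mx0.
case: apex_out; exists (- (a^-1 *: w)) => //.
rewrite /place mulNmx -scalemxAl -[w *m A](addrK (a *: (apex - b))) E sub0r scalerN.
by rewrite scalerA mulVf // scale1r opprK subrK.
Qed.

(** Normal form, up to a constant, of an affine function on the corners: a planar linear form
    written as [cross u], and a free value at the apex. *)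
Definition height (u : 'rV[R]_2) (h : R) (v : option 'I_k) : R :=
  if v is Some i then cross u (p i) else h.

Lemma dot_corner n (u : 'rV[R]_2) : (forall x, dot (n *m A^T) x = cross u x) ->
  forall v, dot n (corner v) = height u (dot n (apex - b)) v + dot n b.
Proof.
move=> nu [i|] /=; last by rewrite dotBr subrK.
by rewrite -nu !dotE /place raddfD /= mulmxDr mxE trmx_mul mulmxA.
Qed.

Lemma height_dot u h : exists n c, forall v, dot n (corner v) = height u h v + c.
Proof.
(* [nu] is [u] turned by a right angle, which makes [dot nu] equal to [cross u]; [n] solves the
   linear system given by [frame]. *)
pose nu : 'rV[R]_2 := \row_i (if i == 0 then - u 0 1 else u 0 0).
pose n := row_mx nu h%:M *m (invmx frame)^T.
have : n *m frame^T = row_mx nu h%:M.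
  by rewrite -mulmxA -trmx_mul mulmxV ?frame_unit // trmx1 mulmx1.
rewrite (@tr_col_mx _ 2 1 3) [_ *m _](@mul_mx_row _ 1 3 2 1) => /(@eq_row_mx _ 1 2 1)[nA nh].
exists n, (dot n b) => v; rewrite (@dot_corner _ u) => [|x].
  by rewrite [dot n (apex - b)]dotE nh mxE mulr1n.
by rewrite nA dot2E !mxE /cross /=; ring.
Qed.

Lemma dot_height n : exists u h c, forall v, dot n (corner v) = height u h v + c.
Proof.
pose nu := n *m A^T; exists (\row_i (if i == 0 then nu 0 1 else - nu 0 0)).
exists (dot n (apex - b)), (dot n b); apply: dot_corner => x.
by rewrite dot2E /cross !mxE /=; ring.
Qed.

Lemma dot_const n i : (forall v, dot n (corner v) = dot n (corner (Some i))) -> n = 0.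
Proof.
move=> nE; pose nu := n *m A^T.
pose u : 'rV[R]_2 := \row_i (if i == 0 then nu 0 1 else - nu 0 0).
have nuE x : dot nu x = cross u x by rewrite dot2E /cross !mxE /=; ring.
have u0 : u = 0.
  apply/eqP; apply: contraT => /(cross_not_const p_inj p_strict i)[j /eqP[]].
  by have := nE (Some j); rewrite !(dot_corner nuE) /= => /addIr.
have nu0 : nu = 0.
  apply/rowP => j; rewrite mxE; have [->|->] : j = 0 \/ j = 1.
  - by case: j => [[|[|//]]] ?; [left|right]; apply: val_inj.
  - by have := congr1 (fun w : 'rV_2 => - w 0 1) u0; rewrite !mxE /= opprK oppr0.
  - by have := congr1 (fun w : 'rV_2 => w 0 0) u0; rewrite !mxE.
have h0 : n *m (apex - b)^T = 0.
  rewrite [LHS]mx11_scalar -dotE.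
  by have := nE None; rewrite !(dot_corner nuE) /= u0 cross0l => /addIr->; rewrite raddf0.
have : n *m frame^T = 0.
  by rewrite (@tr_col_mx _ 2 1 3) [_ *m _](@mul_mx_row _ 1 3 2 1) -/nu nu0 h0 row_mx0.
by move/(canRL (mulmxK _)) => ->; rewrite ?mul0mx // unitmx_tr frame_unit.
Qed.

Lemma corner_inj : injective corner.
Proof.
have place_inj : injective (place A b) by move=> x y /addIr /mulA_inj.
move=> [i|] [j|] //= => [/place_inj/p_inj->//|E|E]; case: apex_out; last by exists (p j).
by exists (p i).
Qed.

Lemma pyramid_corner v : P (corner v).
Proof. by rewrite pyramid_hull; apply: sub_hull; exists v. Qed.

Lemma supporting_height n c : supporting_plane P n c <->
  [/\ n != 0, forall v, dot n (corner v) <= c & exists v, dot n (corner v) = c].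
Proof.
have le : (forall v, dot n (corner v) <= c) -> forall x, range corner x -> dot n x <= c.
  by move=> nc _ [v _ <-].
split=> [[n0 nP [x Px xc]]|[n0 nc [v vc]]].
  have nc v : dot n (corner v) <= c by exact: (nP _ (pyramid_corner v)).
  split=> //; have : [set x | P x /\ dot n x = c] x by [].
  rewrite pyramid_hull hull_face; last exact: le.
  by move=> /hull_nonempty[_ [[v _ <-] vc]]; exists v.
split=> //; last by exists (corner v) => //; exact: pyramid_corner.
by rewrite pyramid_hull; apply: hull_le; exact: le.
Qed.

Lemma height_supporting u h n c v : (forall w, dot n (corner w) = height u h w + c) ->
  (forall w, height u h w <= height u h v) -> (exists w, height u h w < height u h v) ->
  supporting_plane P n (dot n (corner v)).
Proof.
move=> nE vmax [w lt]; apply/supporting_height; split.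
- apply/eqP => n0; move: lt; rewrite ltNge => /negP; apply.
  have := nE v; rewrite n0; have := nE w; rewrite n0 !dot0l.
  lra.
- by move=> x; rewrite !nE lerD2r.
- by exists v.
Qed.

Lemma height_face u h v : (forall w, height u h w <= height u h v) ->
  (exists w, height u h w < height u h v) ->
  face P (hull (corner @` [set w | height u h w = height u h v])).
Proof.
move=> vmax wlt; have [n [c nE]] := height_dot u h.
exists n, (dot n (corner v)); split; first exact: height_supporting nE vmax wlt.
rewrite pyramid_hull hull_face; last by move=> _ [w _ <-]; rewrite !nE lerD2r.
congr hull; apply/seteqP; split=> [_ [w /= wv <-]|_ [[w _ <-]]].
  by split; [exists w|rewrite !nE wv].
by rewrite !nE => /addIr wv; exists w.
Qed.

Lemma vertices_pyramid : vertices P = range corner.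
Proof.
apply/seteqP; split=> [x [n [c [/supporting_height[n0 nc [v vc]] xE]]]|_ [v _ <-]].
  exists v => //; have : [set x | P x /\ dot n x = c] (corner v).
    by split=> //; exact: pyramid_corner.
  by rewrite -xE.
suff [u [h [w hw lt]]] : exists u h, exists2 w, height u h w < height u h v &
    forall w, w <> v -> height u h w < height u h v.
  have := @height_face u h v; rewrite (_ : [set w | _] = [set v]) ?image_set1 ?hull1.
    apply; last by exists w.
    by move=> w'; have [->//|/eqP/lt/ltW] := eqVneq w' v.
  apply/seteqP; split=> [w' /= w'v|w' ->//].
  by apply: contrapT => /lt; rewrite w'v ltxx.
case: v => [i|].
  have [u ui] := vertex_support p_inj p_left p_strict i.
  (* The planar form singles out vertex i within the base, and the apex is put one unit lower. *)
  exists (- u), (- cross u (p i) - 1); exists None => [|[j|]] /=.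
  - by rewrite crossNl; lra.
  - move=> ji; rewrite !crossNl ltrN2; apply: ui; apply: contra_notN ji => /eqP->//.
  - by rewrite crossNl => _; lra.
exists 0, 1; exists (Some i0) => [|[j|//] _] /=; rewrite cross0l; lra.
Qed.

(** Expose [corner x] by its own supporting plane. The part of the segment in that plane is spanned
    by the ends lying there, so one of the ends is [corner x]. *)
Lemma corner_hull x v w : hull [set corner v; corner w] (corner x) -> x = v \/ x = w.
Proof.
move=> hx; have : vertices P (corner x) by rewrite vertices_pyramid; exists x.
case=> n [c [/supporting_height[n0 nc _] xE]].
have only y : dot n (corner y) = c -> y = x.
  move=> yc; apply: corner_inj; have : [set x | P x /\ dot n x = c] (corner y).
    by split=> //; exact: pyramid_corner.
  by rewrite -xE.
have xc : dot n (corner x) = c.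
  by have : [set corner x] (corner x) by []; rewrite xE => -[].
have : [set y | hull [set corner v; corner w] y /\ dot n y = c] (corner x) by [].
rewrite hull_face => [/hull_nonempty[_ [[->|->] /only]]|_ [->|->]//]; by [left|right].
Qed.

Lemma height_edge u h v w x : v != w -> x != v -> x != w ->
  height u h w = height u h v ->
  (forall y, y != v -> y != w -> height u h y < height u h v) ->
  edge P (corner v) (corner w).
Proof.
move=> vw xv xw wv lt; split=> [/corner_inj/eqP|]; first by rewrite (negPf vw).
have -> : [set corner v; corner w] = corner @` [set y | height u h y = height u h v].
  apply/seteqP; split=> [_ [->|->]|_ [y /= yv <-]]; first by exists v.
    by exists w.
  have [->|yv'] := eqVneq y v; first by left.
  have [->|yw] := eqVneq y w; first by right.
  by have := lt _ yv' yw; rewrite yv ltxx.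
apply: height_face; last by exists x; exact: lt.
move=> y; have [->//|yv] := eqVneq y v.
by have [->|yw] := eqVneq y w; [rewrite wv|apply/ltW/lt].
Qed.

Lemma edge_src_tgt e : edge P (corner (src e)) (corner (tgt e)).
Proof.
case: e => [i|a].
  (* For a base edge the apex is put below the edge; for a lateral edge it is put level with vertex
     a. *)
  apply: (@height_edge (- edge_vec p i) (- cross (edge_vec p i) (p i) - 1) _ _ None) => //.
  - by rewrite /= (inj_eq Some_inj) eq_sym (ordS_neq p_strict).
  - by rewrite /= !crossNl edge_end.
  - case=> [j|_ _] /=; rewrite !crossNl; last by lra.
    by rewrite !(inj_eq Some_inj) ltrN2; exact: edge_line_strict.
have [u ua] := vertex_support p_inj p_left p_strict a.
apply: (@height_edge (- u) (- cross u (p a)) _ _ (Some (ordS a))) => //.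
- by rewrite /= (inj_eq Some_inj) (ordS_neq p_strict).
- by rewrite /= crossNl.
- by case=> [j|//] /=; rewrite (inj_eq Some_inj) !crossNl ltrN2 => ja _; exact: ua.
Qed.

Lemma edgeC v w : edge P v w -> edge P w v.
Proof. by case=> vw; rewrite setUC => vwP; split=> // wv; exact/vw. Qed.

Lemma joins_edge e v w : joins e v w -> edge P (corner v) (corner w).
Proof.
by case=> -[-> ->]; [|apply: edgeC]; exact: edge_src_tgt.
Qed.

Lemma edge_joins v w : edge P (corner v) (corner w) -> exists e, joins e v w.
Proof.
case=> vw [n [c [/supporting_height[n0 nc _] hE]]].
have hc x : hull [set corner v; corner w] (corner x) <-> dot n (corner x) = c.
  rewrite hE; split=> [[]//|xc]; split=> //; exact: pyramid_corner.
have vc : dot n (corner v) = c by apply/hc; apply: sub_hull; left.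
have wc : dot n (corner w) = c by apply/hc; apply: sub_hull; right.
have {vw}vw : v <> w by move=> E; apply: vw; rewrite E.
case: v w vw hc vc wc {hE} => [i|] [j|] //= ij hc ic jc; last 2 first.
- by exists (inr i); left.
- by exists (inr j); right.
have [u [h [d nE]]] := dot_height n.
have ijE : cross u (p i) = cross u (p j).
  by have := nE (Some i); have := nE (Some j); rewrite /= ic jc => -> /addIr.
(* [u = 0] would make the whole base level, hence contained in the edge, and the polygon would have
   only two vertices. *)
have [u0|u0] := eqVneq u 0.
  have mij m : m = i \/ m = j.
    suff : Some m = Some i \/ Some m = Some j by case=> -[]; [left|right].
    by apply/corner_hull; apply/hc; rewrite -ic (nE (Some i)) nE u0 /= !cross0l.
  have Sij : ordS i = j.
    by case: (mij (ordS i)) => // /eqP; rewrite (negPf (ordS_neq p_strict i)).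
  case: (mij (ordS (ordS i))) => /eqP.
    by rewrite (negPf (ordS2_neq p_inj p_strict i)).
  by rewrite Sij (negPf (ordS_neq p_strict j)).
have Nu : - u != 0 by rewrite oppr_eq0.
have Nmin m : cross (- u) (p i) <= cross (- u) (p m).
  rewrite !crossNl lerN2; have := nc (Some m).
  by rewrite -ic (nE (Some i)) (nE (Some m)) /= lerD2r.
have nij : i != j by apply/eqP => E; apply: ij; rewrite E.
have := support_consecutive p_inj p_left p_strict Nu Nmin nij erefl.
rewrite !crossNl ijE => /(_ erefl)[->|->]; first by exists (inl i); left.
by exists (inl j); right.
Qed.

(** Parallel supporting planes contain [e] on top and [f] at the bottom; the strict inequality
    excludes the zero functional. *)
Definition opposite e f : Prop := exists u h,
  [/\ height u h (src f) < height u h (src e),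
      forall x, height u h (src f) <= height u h x <= height u h (src e),
      height u h (tgt e) = height u h (src e)
    & height u h (tgt f) = height u h (src f)].

Lemma heightN u h v : height (- u) (- h) v = - height u h v.
Proof. by case: v => [i|] //=; rewrite crossNl. Qed.

Lemma oppositeC e f : opposite e f -> opposite f e.
Proof.
move=> [u [h [lt le eE fE]]]; exists (- u), (- h).
split; rewrite ?heightN ?ltrN2 ?eE ?fE // => x.
by rewrite heightN !lerN2 andbC.
Qed.

Lemma dot_midpoint n (x y : 'rV[R]_3) : dot n (midpoint x y) = 2^-1 * (dot n x + dot n y).
Proof. by rewrite /midpoint scalerDr dotZDr mulrDr. Qed.

Lemma height_joins u h e v w : height u h (tgt e) = height u h (src e) -> joins e v w ->
  height u h v = height u h (src e) /\ height u h w = height u h (src e).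
Proof. by move=> eE [] [-> ->]; rewrite eE. Qed.

Lemma opposite_square e f v w v' w' : joins e v v' -> joins f w w' -> opposite e f ->
  antipodal_square P (corner v) (corner w) (corner v') (corner w').
Proof.
move=> ev fw [u [h [lt le eE fE]]]; have [n [c nE]] := height_dot u h.
have [vE v'E] := height_joins eE ev; have [wE w'E] := height_joins fE fw.
split; [exact: joins_edge ev|exact: joins_edge fw| |].
  move=> /seteqP[/(_ (corner v) (or_introl erefl)) vww' _].
  by move: vww' => /= [] /corner_inj E; move: lt; rewrite -vE E ?wE ?w'E ltxx.
have Pmid x y : P (midpoint (corner x) (corner y)).
  by rewrite pyramid_hull; apply: hull_midpoint; apply: sub_hull; [exists x|exists y].
have mid x y z : height u h x = height u h z -> height u h y = height u h z ->
    dot n (midpoint (corner x) (corner y)) = dot n (corner z).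
  by move=> xz yz; rewrite dot_midpoint !nE xz yz; lra.
split=> //; exists n; rewrite !dotNl (mid _ _ (src e)) // (mid _ _ (src f)) //.
split; first by apply: height_supporting nE _ _ => [x|]; [case/andP: (le x)|exists (src f)].
rewrite -dotNl; apply: (@height_supporting (- u) (- h) _ (- c)).
- by move=> x; rewrite dotNl nE heightN opprD.
- by move=> x; rewrite !heightN lerN2; case/andP: (le x).
- by exists (src e); rewrite !heightN ltrN2.
Qed.

Lemma square_opposite v w v' w' :
  antipodal_square P (corner v) (corner w) (corner v') (corner w') ->
  exists e f, [/\ joins e v v', joins f w w' & opposite e f].
Proof.
case=> /edge_joins[e ev] /edge_joins[f fw] _ [_ _ [n [nS n'S]]].
case/supporting_height: nS => n0 nle _; case/supporting_height: n'S => _ n'le _.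
have [u [h [c nE]]] := dot_height n.
(* A maximum attained at a midpoint is attained at both ends. *)
have [vE v'E] := face_midpoint (nle v) (nle v') erefl.
have [wE w'E] := face_midpoint (n'le w) (n'le w') erefl.
exists e, f; split=> //.
have ee : dot n (corner (src e)) = dot n (midpoint (corner v) (corner v')) /\
    dot n (corner (tgt e)) = dot n (midpoint (corner v) (corner v')).
  by case: ev => -[<- <-].
have ff : dot (- n) (corner (src f)) = dot (- n) (midpoint (corner w) (corner w')) /\
    dot (- n) (corner (tgt f)) = dot (- n) (midpoint (corner w) (corner w')).
  by case: fw => -[<- <-].
case: ee ff => e1 e2 [f1 f2].
have le x : height u h (src f) <= height u h x <= height u h (src e).
  have := nle x; have := n'le x; rewrite -e1 -f1 !dotNl !nE => xf xe.
  by apply/andP; split; lra.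
exists u, h; split=> //.
- rewrite ltNge; apply/negP => ge; move/eqP: n0; apply.
  apply: (@dot_const _ i0) => x; rewrite !nE.
  by have := le x; have := le (Some i0); move=> /andP[? ?] /andP[? ?]; lra.
- by have := nE (tgt e); have := nE (src e); rewrite e1 e2; lra.
- by have := nE (tgt f); have := nE (src f); move: f1 f2; rewrite !dotNl; lra.
Qed.

Lemma opposite_base i j :
  opposite (inl i) (inl j) <-> i != j /\ parallel_edges p i j.
Proof.
split=> [[u [h [/= lt le iE jE]]]|[ij par]].
  have u0 : u != 0 by apply: contraTneq lt => ->; rewrite !cross0l ltxx.
  split; first by apply: contraTneq lt => ->; rewrite ltxx.
  rewrite parallel_edgesE //; apply/eqP; apply: (cross_colinear u0).
    by rewrite crossBr iE subrr.
  by rewrite crossBr jE subrr.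
have [aj aSj] := parallel_antipodal p_inj p_left p_strict ij par.
(* The top plane carries the side face over edge i, since the apex is level with that edge. *)
exists (- edge_vec p i), (- cross (edge_vec p i) (p i)).
rewrite /height /= !crossNl edge_end // ltrN2 (antipodal_vertex_gt p_inj p_left p_strict aj).
have Sj : cross (edge_vec p i) (p (ordS j)) = cross (edge_vec p i) (p j).
  by apply/eqP; rewrite eq_le (antipodal_vertexP _ _ _ aj) (antipodal_vertexP _ _ _ aSj).
rewrite Sj; split=> // -[m|]; rewrite ?crossNl !lerN2 ?lexx.
  by rewrite (antipodal_vertexP _ _ _ aj) edge_line.
by rewrite edge_line.
Qed.

Lemma opposite_mixed i a : opposite (inl i) (inr a) <-> antipodal_vertex p i a.
Proof.
split=> [[u [h [/= lt le iE aE]]]|ia].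
  have u0 : u != 0 by apply: contraTneq lt => ->; rewrite !cross0l ltxx.
  (* Edge i is level, so [u] is a multiple of its vector; the factor is negative because a lies
     strictly lower. *)
  have ui : cross u (edge_vec p i) = 0 by rewrite crossBr iE subrr.
  have uE := cross_eq0P u0 ui; move: (_ / _) => l in uE.
  have l0 : l != 0.
    by apply: contraTneq (edge_vec_neq0 p_inj p_strict i) => l0; rewrite uE l0 scale0r eqxx.
  have {l0}l_lt0 : l < 0.
    rewrite lt_neqAle l0 leNgt; apply/negP => l_gt0.
    by have := edge_line p_left i a; rewrite uE !crossZl ler_pM2l // leNgt lt.
  apply/antipodal_vertexP => m; rewrite uE !crossZl ler_nM2l //.
  by case/andP: (le (Some m)).
(* The apex is put level with vertex a, so the lateral edge lies in the bottom plane. *)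
exists (- edge_vec p i), (- cross (edge_vec p i) (p a)).
rewrite /height /= !crossNl edge_end // ltrN2 (antipodal_vertex_gt p_inj p_left p_strict ia).
split=> // -[m|]; rewrite ?crossNl !lerN2 ?lexx.
  by rewrite (antipodal_vertexP _ _ _ ia) edge_line.
by rewrite edge_line.
Qed.

Lemma not_opposite_lateral a a' : ~ opposite (inr a) (inr a').
Proof. by move=> [u [h [/= lt _ aE a'E]]]; move: lt; rewrite -aE -a'E ltxx. Qed.

End PyramidGeometry.

(** * Belts of the pyramid *)

Lemma injective_surjective_bijective (U V : Type) (f : U -> V) :
  injective f -> (forall y, exists x, f x = y) -> bijective f.
Proof.
move=> f_inj /choice[g fg]; exists g => // x.
by apply: f_inj; rewrite fg.
Qed.

Section PyramidBelts.
Variables (R : realType) (k : nat) (p : 'I_k -> 'rV[R]_2).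
Variables (A : 'M[R]_(2, 3)) (b apex : 'rV[R]_3).
Hypothesis p_inj : injective p.
Hypothesis p_left : forall i j, 0 <= cross (edge_vec p i) (p j - p i).
Hypothesis p_strict : no_collinear_adjacent_edges p.
Hypothesis A_isom : isometric_placement A.
Variable i0 : 'I_k.
Hypothesis apex_out : ~ range (place A b) apex.

Local Notation P := (pyramid p A b apex).
Local Notation corner := (corner p A b apex).
Local Notation opposite := (opposite p).

Let verticesE : vertices P = range corner :=
  vertices_pyramid p_inj p_left p_strict A_isom i0 apex_out.

Lemma mem_vert x : (x \in vert P) = `[< range corner x >].
Proof.
rewrite /vert verticesE in_fset_set; last exact: finite_image.
by apply/idP/asboolP => [/set_mem|/mem_set].
Qed.

Lemma corner_vert v : corner v \in vert P.
Proof. by rewrite mem_vert; apply/asboolP; exists v. Qed.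

Definition vertex_of (v : option 'I_k) : vert P := [` corner_vert v]%fset.

Lemma vertex_of_bij : bijective vertex_of.
Proof.
apply: injective_surjective_bijective => [v w /(congr1 val) /=|[x xP]].
  exact: corner_inj.
by have := xP; rewrite mem_vert => /asboolP[v _ vx]; exists v; apply: val_inj.
Qed.

Lemma sum_vertex (F : vert P -> rat) : \sum_x F x = \sum_v F (vertex_of v).
Proof. by rewrite (reindex vertex_of) //; exact/onW_bij/vertex_of_bij. Qed.

(** * Reading a 2-chain as a pairing on edges *)

Section Decoding.
Variable z : chain2 P.

Definition corner_chain v w v' w' : rat :=
  z (vertex_of v, vertex_of w, vertex_of v', vertex_of w').

Definition pairing_of (e f : 'I_k + 'I_k) : rat :=
  corner_chain (src e) (src f) (tgt e) (tgt f).

Lemma corner_chain_rot v w v' w' : corner_chain w v' w' v = corner_chain v w v' w'.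
Proof. by rewrite /corner_chain; case: z => z' /= /asboolP[_ -> _]. Qed.

Lemma corner_chain_rev v w v' w' : corner_chain v w' v' w = - corner_chain v w v' w'.
Proof. by rewrite /corner_chain; case: z => z' /= /asboolP[_ _ ->]. Qed.

Lemma corner_chain_neq0 v w v' w' : corner_chain v w v' w' != 0 ->
  exists e f, [/\ joins e v v', joins f w w' & opposite e f].
Proof.
rewrite /corner_chain; case: z => z' /= /asboolP[zs _ _] /zs /=.
exact: square_opposite.
Qed.

Lemma pairing_ofC e f : pairing_of f e = - pairing_of e f.
Proof. by rewrite /pairing_of -corner_chain_rev -corner_chain_rot. Qed.

Lemma pairing_of_opposite e f : pairing_of e f != 0 -> opposite e f.
Proof.
have S2 i := ordS2_neq p_inj p_strict i.
have self (g : 'I_k + 'I_k) : joins g (src g) (tgt g) by left.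
by case/corner_chain_neq0 => e' [f' [/(joins_inj S2 (self e)) <- /(joins_inj S2 (self f)) <-]].
Qed.

(** The four ways to orient the two diagonal edges differ by rotations and reversals of the cycle;
    off the squares both sides vanish. *)
Lemma corner_chain_pair v w v' w' :
  corner_chain v w v' w' = pair_chain pairing_of v w v' w'.
Proof.
have S i := ordS_neq p_strict i; have S2 i := ordS2_neq p_inj p_strict i.
have [[e [f [ev fw]]]|nex] := pselect (exists e f, joins e v v' /\ joins f w w').
  rewrite (pair_chain_joins S2 _ ev fw); case: ev fw => -[-> ->] [] [-> ->].
  - by rewrite !edge_sign_src // !mul1r.
  - by rewrite (edge_signN f) !edge_sign_src // mul1r mulN1r -corner_chain_rev.
  - rewrite (edge_signN e) !edge_sign_src // mulr1 mulN1r -corner_chain_rev.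
    by rewrite -2!corner_chain_rot.
  - rewrite (edge_signN f) (edge_signN e) !edge_sign_src // mulrNN !mul1r.
    by rewrite -2!corner_chain_rot.
transitivity (0 : rat).
  apply/eqP; apply: contraT => /corner_chain_neq0[e [f [ev fw _]]].
  by case: nex; exists e, f.
apply/esym/eqP; apply: contraT => /pair_chain_neq0[e [f [ev fw _]]].
by case: nex; exists e, f.
Qed.

Lemma boundary_vertex_of v w :
  boundary z (vertex_of v, vertex_of w) = pair_boundary pairing_of v w.
Proof.
rewrite /= ffunE /= -sum_pair_chain.
rewrite -(pair_bigA _ (fun x y => z (vertex_of v, vertex_of w, x, y))) /= sum_vertex.
apply: eq_bigr => v' _; rewrite sum_vertex; apply: eq_bigr => w' _.
exact: corner_chain_pair.
Qed.

Lemma boundary_eq0 : boundary z = 0 <-> forall v w, pair_boundary pairing_of v w = 0.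
Proof.
split=> [z0 v w|z0]; first by rewrite -boundary_vertex_of z0 /= ffunE.
apply/val_inj/ffunP => -[x y]; have [g _ gK] := vertex_of_bij.
by rewrite -(gK x) -(gK y) boundary_vertex_of z0 /= ffunE.
Qed.

Lemma chain_eq0 : (forall e f, pairing_of e f = 0) -> z = 0.
Proof.
move=> G0; apply/val_inj/ffunP => -[[[x1 x2] x3] x4]; have [g _ gK] := vertex_of_bij.
rewrite -(gK x1) -(gK x2) -(gK x3) -(gK x4) ffunE.
rewrite -/(corner_chain _ _ _ _) corner_chain_pair /pair_chain.
by rewrite big1 // => e _; rewrite big1 // => f _; rewrite G0 mulr0.
Qed.

End Decoding.

Lemma chain_of_pairing (G : 'I_k + 'I_k -> 'I_k + 'I_k -> rat) :
  (forall e f, G f e = - G e f) -> (forall e f, G e f != 0 -> opposite e f) ->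
  exists z : chain2 P, forall e f, pairing_of z e f = G e f.
Proof.
move=> GC Gopp; have [g vK gK] := vertex_of_bij.
pose z : {ffun vert P * vert P * vert P * vert P -> rat^o} :=
  [ffun t => let: (x1, x2, x3, x4) := t in pair_chain G (g x1) (g x2) (g x3) (g x4)].
have zP : z \in @chain2_pred R P.
  apply/asboolP; split=> x y x' y'; rewrite !ffunE.
  - move=> /pair_chain_neq0[e [f [ex fy /Gopp ef]]].
    by rewrite -(gK x) -(gK y) -(gK x') -(gK y'); apply: opposite_square ef.
  - exact: pair_chain_rot.
  - exact: pair_chain_rev.
exists (Chain2 zP) => e f.
have S i := ordS_neq p_strict i; have S2 i := ordS2_neq p_inj p_strict i.
rewrite /pairing_of /corner_chain /= ffunE !vK.
have self (h : 'I_k + 'I_k) : joins h (src h) (tgt h) by left.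
by rewrite (pair_chain_joins S2 _ (self e) (self f)) !edge_sign_src // !mul1r.
Qed.

End PyramidBelts.

(** * The coordinate isomorphism *)

Theorem theorem10p10 (R : realType) (k : nat) (p : 'I_k -> 'rV[R]_2)
    (A : 'M[R]_(2, 3)) (b apex : 'rV[R]_3) :
  convex_polygon p ->
  no_collinear_adjacent_edges p ->
  isometric_placement A ->
  ~ range (place A b) apex ->
  exists phi : {linear belt (pyramid p A b apex) ->
                       {ffun {s : {set 'I_k} | parallel_pair p s} -> 'rV[rat]_2}},
    bijective phi.
Proof.
move=> [p_inj p_left [i0 _]] p_strict A_isom apex_out.
set P := pyramid p A b apex; pose S := {s : {set 'I_k} | parallel_pair p s}.
pose par := parallel_edges p.
(* [r] orders each parallel pair, which fixes the order of its two coordinates. *)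
have /choice[r rP] : forall s : S, exists ij : 'I_k * 'I_k,
    [/\ ij.1 != ij.2, val s = [set ij.1; ij.2]%SET & par ij.1 ij.2].
  by case=> s /= /existsP[i /existsP[j /and3P[ij /eqP sij pij]]]; exists (i, j).
have parNS i : ~~ par i (ordS i) by exact: p_strict.
have par_sym : symmetric par by exact: parallel_edges_sym.
have r_ex i j : i != j -> par i j -> exists s, r s = (i, j) \/ r s = (j, i).
  move=> ij pij; have sP : parallel_pair p [set i; j]%SET.
    by apply/existsP; exists i; apply/existsP; exists j; rewrite ij eqxx.
  pose s : S := exist _ [set i; j]%SET sP.
  exists s; case: (rP s); case: (r _) => a c /= ac E _.
  have : i \in [set a; c]%SET by rewrite -E !inE eqxx.
  have : j \in [set a; c]%SET by rewrite -E !inE eqxx orbT.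
  rewrite !inE => /orP[] /eqP jE /orP[] /eqP iE; rewrite ?iE ?jE; try by [left|right].
    by rewrite iE jE eqxx in ij.
  by rewrite iE jE eqxx in ij.
have r_inj s s' : r s' = r s \/ r s' = ((r s).2, (r s).1) -> s' = s.
  move=> E; apply: val_inj; case: (rP s) => _ -> _; case: (rP s') => _ -> _.
  by case: E => -> //=; rewrite finset.setUC.
pose x (z : belt P) i j :=
  pairing_of p_inj p_left p_strict A_isom i0 apex_out z (inl i) (inr j).
pose phi (z : belt P) : {ffun S -> 'rV[rat]_2} :=
  [ffun s => \row_t if t == 0 then x z (r s).1 (r s).2 else x z (r s).2 (r s).1].
have phi_lin : linear phi.
  move=> c z z'; apply/ffunP => s; apply/rowP => t; rewrite !(ffunE, mxE).
  by case: ifP => _; rewrite /x /pairing_of /corner_chain /= !ffunE.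
pose Phi : {linear belt P -> {ffun S -> 'rV[rat]_2}} :=
  HB.pack phi (GRing.isLinear.Build _ _ _ _ phi phi_lin).
exists Phi.
apply: injective_surjective_bijective => [|u].
  apply: raddf_inj => z /= phi0; apply: val_inj.
  transitivity (0 : chain2 P); last by rewrite raddf0.
  apply: (chain_eq0 (p_inj := p_inj) (p_left := p_left) (p_strict := p_strict)
    (A_isom := A_isom) (i0 := i0) (apex_out := apex_out)) => e f.
  have x0 s : x z (r s).1 (r s).2 = 0 /\ x z (r s).2 (r s).1 = 0.
    split; have /ffunP/(_ s)/rowP := phi0; [move/(_ 0)|move/(_ 1)]; by rewrite !(ffunE, mxE).
  apply: (pairing0 (par := par) (anti := antipodal_vertex p)) => //.
  - exact: antipodal_vertex_neq.
  - exact: antipodal_vertices_parallel.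
  - exact: pairing_ofC.
  - by move=> i j /pairing_of_opposite/opposite_base; apply.
  - by move=> i a /pairing_of_opposite/opposite_mixed; apply.
  - move=> a a'; apply/eqP; apply: contraT => /pairing_of_opposite.
    by move/not_opposite_lateral.
  - apply/boundary_eq0; case: z {x0 phi0} => z zB; exact/eqP.
  - by move=> i j ij /(r_ex _ _ ij)[s rs]; have := x0 s; case: rs => -> /= [].
(* Weights for the triangle belts: the prescribed coordinates at the two orderings of each parallel
   pair, and 0 elsewhere. *)
pose w i j := \sum_s ((r s == (i, j))%:R * u s 0 0 + (r s == (j, i))%:R * u s 0 1).
have w_neq0 i j : w i j != 0 -> i != j /\ par i j.
  move=> w0; apply: contrapT => nij; move/eqP: w0; apply; rewrite /w big1 // => s _.
  have [ij _ pij] := rP s; case: eqP => [rs|_]; first by case: nij; rewrite rs in ij pij.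
  case: eqP => [rs|_]; last by rewrite !mul0r addr0.
  by case: nij; rewrite rs in ij pij; rewrite eq_sym par_sym.
have wr s : w (r s).1 (r s).2 = u s 0 0 /\ w (r s).2 (r s).1 = u s 0 1.
  have sw : (r s == ((r s).2, (r s).1)) = false.
    by have [ij _ _] := rP s; apply: contraNF ij => /eqP/(congr1 fst) /= ->.
  have other s' : s' != s -> (r s' == r s) = false /\ (r s' == ((r s).2, (r s).1)) = false.
    by move=> s's; split; apply: contraNF s's => /eqP E; apply/eqP/r_inj; [left|right].
  split; rewrite /w (bigD1 s) //= -surjective_pairing eqxx sw mul1r mul0r.
    rewrite addr0 big1 ?addr0 // => s' /other[-> ->].
    by rewrite !mul0r addr0.
  rewrite add0r big1 ?addr0 // => s' /other[-> ->].
  by rewrite !mul0r addr0.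
(* A nonzero coefficient at lateral edge a means that edge a or a - 1 is parallel to i, so vertex a,
   an end of both, is furthest from i. *)
have wopp e f : triangle_pairing w e f != 0 -> opposite p e f.
  have wanti i a : w i a - w i (ord_pred a) != 0 -> opposite p (inl i) (inr a).
    move=> wia; apply/opposite_mixed => //; have [w0|/w_neq0[ia pia]] := eqVneq (w i a) 0.
      move: wia; rewrite w0 sub0r oppr_eq0 => /w_neq0[ia pia].
      by rewrite -[a]ord_predK; have [] := parallel_antipodal p_inj p_left p_strict ia pia.
    by have [] := parallel_antipodal p_inj p_left p_strict ia pia.
  case: e f => [i|a] [j|a'] /=.
  - move=> wij; apply/opposite_base => //; have [w0|/w_neq0//] := eqVneq (w i j) 0.
    by move: wij; rewrite w0 subr0 => /w_neq0; rewrite eq_sym -[parallel_edges _ _ _]par_sym.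
  - exact: wanti.
  - by rewrite -oppr_eq0 opprB => /wanti/oppositeC.
  - by [].
have [z zE] := chain_of_pairing p_inj p_left p_strict A_isom i0 apex_out
  (triangle_pairingC w) wopp.
have zB : z \in @belt_pred R P.
  apply/eqP; apply/(boundary_eq0 p_inj p_left p_strict A_isom i0 apex_out) => v v'.
  rewrite -(boundary_triangle_pairing w v v') /pair_boundary.
  by apply: eq_bigr => e _; congr (_ * _); apply: eq_bigr => f _; rewrite zE.
exists (Belt zB); apply/ffunP => s; apply/rowP => t; rewrite !(ffunE, mxE) /x !zE /=.
(* The coordinate read off is [w i j - w i (ord_pred j)]. The second term vanishes: edge j - 1 is
   adjacent to j, hence not parallel to i. *)
have pred0 i j : i != j -> par i j -> w i (ord_pred j) = 0.
  move=> ij pij; apply/eqP; apply: contraT => /w_neq0[_ pij'].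
  have /negP[] := parNS (ord_pred j); rewrite ord_predK.
  by apply: (parallel_edges_trans (y := i)); rewrite // -/(par _ _) par_sym.
have [ij _ pij] := rP s; rewrite !pred0 ?subr0 //; try by [rewrite eq_sym|rewrite par_sym].
have [-> ->] := wr s; case: t => [[|[|//]]] ? /=; congr (u s 0 _); exact: val_inj.
Qed.
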